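(* Let $\mathbb{D}:\mathbb{R}\to\mathbb{R}$ be a non-negative convex function with $\mathbb{D}(0)=0$, let $\mathbb{X}$ be the indicator function of a non-empty closed convex set (an interval) $\Theta^\star\subseteq\mathbb{R}$, let $Y$ be a mean zero real random variable, and let $\mathbb{Z}(u)=\mathbb{D}(u)+\mathbb{X}(u)+uY$, $u\in\mathbb{R}$. Assume that $W$, the minimizer of $\mathbb{Z}$ over $\mathbb{R}$, is well-defined (i.e. almost surely exists and is unique). If $Y$ is a symmetric random variable ($Y\overset{d}{=}-Y$) whose measure dominates the Lebesgue measure on $\mathbb{R}$, then $W$ is symmetrically distributed around zero ($W\overset{d}{=}-W$) if and only if the function $u\mapsto\mathbb{D}(u)+\mathbb{X}(u)$ is even.
   Context: The indicator function of $\Theta^\star$ is $\mathbb{X}(u)=0$ if $u\in\Theta^\star$ and $\mathbb{X}(u)=+\infty$ otherwise. The law $P_Y$ of $Y$ dominates Lebesgue measure if every Borel set of $P_Y$-measure zero has Lebesgue measure zero. A function $f$ is even if $f(-u)=f(u)$ for all $u$. *)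

(* Defs.v *)
From HB Require Import structures.
From mathcomp Require Import all_boot all_order all_algebra.
From mathcomp Require Import all_classical all_reals all_analysis.
From mathcomp Require Import measurable_realfun.

Set Implicit Arguments.
Unset Strict Implicit.
Unset Printing Implicit Defensive.

Import Order.TTheory GRing.Theory Num.Theory.
Import numFieldNormedType.Exports.

Local Open Scope classical_set_scope.
Local Open Scope ring_scope.
Local Open Scope ereal_scope.

(* Indicator in the sense of convex analysis, not the 0/1-valued [\1_A]. *)
Definition cvx_indicator (T : Type) (R : realType) (A : set T) (u : T) : \bar R :=
  if u \in A then 0 else +oo.

Definition objective (R : realType) (D : R -> R) (Theta : set R) (u : R) : \bar R :=
  (D u)%:E + cvx_indicator R Theta u.

Definition Zproc (R : realType) (T : Type) (D : R -> R) (Theta : set R)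
    (Y : T -> R) (t : T) (u : R) : \bar R :=
  objective D Theta u + (u * Y t)%:E.

Definition is_minimizer (U : Type) (R : realType) (f : U -> \bar R) (u : U) : Prop :=
  forall v, f u <= f v.

(* Equality of laws is required on measurable sets only: [distribution P X] is
   a set function defined on all sets, and carries no information on the
   non-measurable ones. *)
Definition eq_in_law d d' (T : measurableType d) (T' : measurableType d')
    (R : realType) (P : probability T R) (X X' : {RV P >-> T'}) : Prop :=
  forall A : set T', measurable A -> distribution P X A = distribution P X' A.

Definition symmetric_rv d (T : measurableType d) (R : realType)
    (P : probability T R) (X : {RV P >-> R}) : Prop :=
  eq_in_law X (- X)%R.

Definition even_function (U : zmodType) (V : Type) (f : U -> V) : Prop :=
  forall u, f (- u)%R = f u.

(* Main.v *)
(**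
For convex [D], every [u] in [Theta] minimizes [v |-> D v + v * y] over [Theta] for the
tilt [y = - s], where [s] is a subgradient of [D] at [u], and minimizers are antitone in
[y].  If [W] is symmetric, comparing the tails of [W] and [- W] (using that [Y] is
symmetric and charges every open interval) shows that minimizers [w], [v] for tilts
[y], [z] satisfy [w + v <= 0] when [y + z > 0], and [w + v >= 0] when [y + z < 0].  Hence
[Theta = - Theta], and the subgradients of [D] at [x] and [- x] are essentially opposite;
summing them along a partition of [[0, u]] gives [D (- u) = D u].  Conversely, up to a null
set [W > c] is an event [Y \in B] with [B] an interval, and evenness turns [- W > c] into
[- Y \in B].
*)
Require Import Defs.
From HB Require Import structures.
From mathcomp Require Import all_boot all_order all_algebra.
From mathcomp Require Import all_classical all_reals all_analysis.
From mathcomp Require Import measurable_realfun.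
From mathcomp Require Import ring lra.

Import Order.TTheory GRing.Theory Num.Theory.
Import numFieldNormedType.Exports.

Local Open Scope classical_set_scope.
Local Open Scope ring_scope.

(** * Convexity and subgradients on the line *)

Definition subgradient {R : realType} (D : R -> R) (u s : R) : Prop :=
  forall v, D u + s * (v - u) <= D v.

Lemma convex_function_ineq {R : realType} (D : R -> R) (a b c : R) :
  @convex_function R R^o setT D -> a < b -> b < c ->
  (c - a) * D b <= (c - b) * D a + (b - a) * D c.
Proof.
move=> D_convex ab bc.
have ca : 0 < c - a by lra.
have t01 : 0 <= (c - b) / (c - a) <= 1.
  by rewrite divr_ge0 ?ler_pdivrMr ?mul1r /=; lra.
set t := (c - b) / (c - a) in t01.
have := D_convex (Itv01 (proj1 (andP t01)) (proj2 (andP t01))) a c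
  (in_setT _) (in_setT _).
rewrite -[X in X <= _]/(D (t * a + (1 - t) * c)).
rewrite -[X in _ <= X]/(t * D a + (1 - t) * D c).
have -> : t * a + (1 - t) * c = b by rewrite /t; field; lra.
rewrite -(ler_pM2l ca) => /le_trans; apply.
rewrite le_eqVlt; apply/orP; left; apply/eqP.
by rewrite /t; field; lra.
Qed.

(** The supremum of the left chord slopes at [u], the left derivative, works: by convexity every
    right chord slope bounds them from above. *)
Lemma convex_subgradient {R : realType} (D : R -> R) :
  @convex_function R R^o setT D -> forall u, exists s, subgradient D u s.
Proof.
move=> D_convex u.
pose slopes := [set (D u - D a) / (u - a) | a in [set a | a < u]].
have slopes_ub c : u < c -> ubound slopes ((D c - D u) / (c - u)).
  move=> uc _ [a /= au <-].
  have := convex_function_ineq _ _ _ _ D_convex au uc.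
  by rewrite ler_pdivrMr ?subr_gt0// mulrAC ler_pdivlMr ?subr_gt0//; lra.
have slopes_sup : has_sup slopes.
  split; first by exists ((D u - D (u - 1)) / (u - (u - 1))), (u - 1) => //=; lra.
  by exists ((D (u + 1) - D u) / (u + 1 - u)); apply: slopes_ub; lra.
exists (sup slopes) => v.
have [vu|uv|->] := ltgtP v u; last by lra.
- have : (D u - D v) / (u - v) <= sup slopes.
    by apply: ub_le_sup; [case: slopes_sup|exists v].
  by rewrite ler_pdivrMr ?subr_gt0//; lra.
- have : sup slopes <= (D v - D u) / (v - u).
    by apply: ge_sup; [case: slopes_sup|exact: slopes_ub].
  by rewrite ler_pdivlMr ?subr_gt0//; lra.
Qed.

(* Adding up the subgradient inequalities along a partition of mesh [u / n], the slopes
   at reflected points nearly cancel, and the error terms telescope. *)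
Lemma le_reflect_of_subgradient {R : realType} (D s : R -> R) (u : R) :
  0 <= u -> (forall x, subgradient D x (s x)) ->
  (forall x y, - u <= x <= u -> - u <= y <= u -> 0 < x + y -> 0 <= s x + s y) ->
  D (- u) <= D u.
Proof.
rewrite le_eqVlt => /orP[/eqP<-|u_gt0] Ds s_sum; first by rewrite oppr0.
have partition n : D (- u) - D u <= (- (2 * s (- u)) * u) / n.+1%:R.
  pose e := u / n.+1%:R.
  have e_gt0 : 0 < e by rewrite divr_gt0 ?ltr0n.
  have ne : n.+1%:R * e = u by rewrite mulrC divfK ?pnatr_eq0.
  have step i : (i <= n)%N ->
      D (- (i.+1%:R * e)) - D (i.+1%:R * e) <=
      - e * (s (- (i.+1%:R * e)) + s (- (i%:R * e))).
    elim: i => [|i IH] lein.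
      have := Ds (- (1 * e)) 0; have := Ds 0 (1 * e).
      by rewrite !mul0r oppr0; lra.
    have bound j : (j <= n.+1)%N -> 0 <= j%:R * e <= u.
      by move=> jn; rewrite mulr_ge0 ?ler0n ?(ltW e_gt0)//= -ne ler_pM2r// ler_nat.
    set x := i%:R * e.
    have x1 : i.+1%:R * e = x + e by rewrite -natr1 /x; ring.
    have x2 : i.+2%:R * e = x + e + e by rewrite -natr1 mulrDl x1 mul1r.
    have := bound _ (leqW (ltnW lein)); have := bound _ (leqW lein).
    have := IH (ltnW lein); rewrite x1 x2 -/x => IHx b1 b0.
    (* [- x] is paired with [x + e] rather than with [x], because [s_sum] asks for a strictly
       positive sum. *)
    have S : 0 <= s (x + e) + s (- x) by apply: s_sum; lra.
    have := Ds (- (x + e + e)) (- (x + e)); have := Ds (x + e) (x + e + e).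
    have := mulr_ge0 (ltW e_gt0) S.
    lra.
  have := step n (leqnn n); rewrite ne => /le_trans; apply.
  have -> : - (2 * s (- u)) * u / n.+1%:R = - e * (s (- u) + s (- u)).
    by rewrite /e; ring.
  rewrite ler_nM2l ?oppr_lt0// lerD2l.
  have ltne : n%:R * e = u - e by rewrite -ne -natr1; ring.
  (* Adding these two inequalities yields [s (- u) <= s (- (u - e))], so the leftover is at most
     [- 2 * s (- u) * e], which vanishes with the mesh. *)
  have := Ds (- u) (- (n%:R * e)); have := Ds (- (n%:R * e)) (- u).
  rewrite ltne.
  nra.
rewrite -subr_le0.
have cvg0 : (fun n => (- (2 * s (- u)) * u) / n.+1%:R) @ \oo --> (0 : R).
  rewrite -(mulr0 (- (2 * s (- u)) * u)).
  by apply: cvgM; [exact: cvg_cst|exact: cvg_harmonic].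
apply: cvgr_to_ge cvg0 _.
by apply: nearW => n; exact: partition.
Qed.

(** * Almost sure comparison of events *)

Lemma ae_le_measure {R : realType} {d : measure_display} {T : measurableType d}
    (mu : {measure set T -> \bar R}) (A B : set T) :
  measurable A -> measurable B -> {ae mu, forall t, A t -> B t} ->
  (mu A <= mu B)%E.
Proof.
move=> mA mB [N [mN N0 AB]].
rewrite -(measureU0 mB mN N0); apply: le_measure; rewrite ?inE//.
  exact: measurableU.
move=> t At; have [Bt|nBt] := pselect (B t); [by left|right].
by apply: AB => /= /(_ At).
Qed.

Lemma ae_exists {R : realType} {d : measure_display} {T : measurableType d}
    (mu : {measure set T -> \bar R}) (A : set T) (Q : T -> Prop) :
  measurable A -> (0 < mu A)%E -> {ae mu, forall t, Q t} ->
  exists t, A t /\ Q t.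
Proof.
move=> mA A_gt0 aeQ; have [//|nAQ] := pselect (exists t, A t /\ Q t).
suff : (mu A <= mu set0)%E by rewrite measure0 leNgt A_gt0.
apply: ae_le_measure => //; apply: filterS aeQ => t Qt At.
by apply: nAQ; exists t.
Qed.

(** The form in which domination is used: a null interval would have Lebesgue measure zero, yet its
    length is [b - a]. *)
Lemma distribution_itv_gt0 {R : realType} {d : measure_display} {T : measurableType d}
    (P : probability T R) (Y : {RV P >-> R}) (a b : R) :
  content_dominates (distribution P Y) (@lebesgue_measure R) -> a < b ->
  (0 < P (Y @^-1` `]a, b[))%E.
Proof.
move=> Ydom ab; rewrite lt0e measure_ge0 andbT; apply/eqP => PY0.
have := Ydom _ (measurable_itv `]a, b[) PY0.
by rewrite lebesgue_measure_itv/= lte_fin ab -EFinB => -[] /eqP; rewrite subr_eq0 gt_eqF.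
Qed.

(** * The constraint interval and tilted minimizers *)

Lemma convex_set_itv {R : realType} (Theta : set R) (a b x : R) :
  @convex_set R R^o Theta -> Theta a -> Theta b -> a <= x <= b -> Theta x.
Proof.
move=> Theta_convex Ta Tb /andP[]; rewrite le_eqVlt => /orP[/eqP<-//|ax].
rewrite le_eqVlt => /orP[/eqP->//|xb].
have t01 : 0 <= (b - x) / (b - a) <= 1.
  by rewrite divr_ge0 ?ler_pdivrMr ?mul1r /=; lra.
set t := (b - x) / (b - a) in t01.
have := Theta_convex a b (Itv01 (proj1 (andP t01)) (proj2 (andP t01)))
  (mem_set Ta) (mem_set Tb).
move/set_mem; rewrite -[X in Theta X]/(t * a + (1 - t) * b).
suff -> : t * a + (1 - t) * b = x by [].
by rewrite /t; field; lra.
Qed.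

(** A constraint replaces the value [+oo] and a fixed tilt replaces [Y t], so that everything stays
    in real arithmetic. *)
Definition tilted_argmin {R : realType} (D : R -> R) (Theta : set R) (y w : R) : Prop :=
  Theta w /\ forall v, Theta v -> D w + w * y <= D v + v * y.

(** A point of [Theta] forces the minimum to be finite; were [Theta] empty, every point would
    minimize the constant [+oo]. *)
Lemma is_minimizer_Zproc {R : realType} (T : Type) (D : R -> R) (Theta : set R)
    (Y : T -> R) (t : T) (w : R) : Theta !=set0 ->
  is_minimizer (Zproc D Theta Y t) w <-> tilted_argmin D Theta (Y t) w.
Proof.
move=> [a Ta]; rewrite /is_minimizer /Zproc /objective /cvx_indicator.
split=> [wmin|[Tw wmin] v].
  have Tw : Theta w.
    have := wmin a; rewrite (mem_set Ta); case: ifPn => [/set_mem//|_].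
    by rewrite addey// addye// leye_eq.
  split=> // v Tv; have := wmin v.
  by rewrite (mem_set Tw) (mem_set Tv) !adde0 -!EFinD lee_fin.
rewrite (mem_set Tw); case: ifPn => [/set_mem/wmin|_].
  by rewrite !adde0 -!EFinD lee_fin.
by rewrite [in leRHS]addey// addye// leey.
Qed.

Lemma tilted_argmin_subgradient {R : realType} (D : R -> R) (Theta : set R) (u s : R) :
  subgradient D u s -> Theta u -> tilted_argmin D Theta (- s) u.
Proof. by move=> sub Tu; split=> // v _; have := sub v; lra. Qed.

(** Adding the two optimality inequalities gives [(w' - w) * (y' - y) <= 0]. *)
Lemma tilted_argmin_antitone {R : realType} (D : R -> R) (Theta : set R) (y y' w w' : R) :
  tilted_argmin D Theta y w -> tilted_argmin D Theta y' w' -> y < y' -> w' <= w.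
Proof.
move=> [Tw wmin] [Tw' wmin'] yy'; rewrite leNgt; apply/negP => ww'.
have := wmin _ Tw'; have := wmin' _ Tw.
have : 0 < (w' - w) * (y' - y) by rewrite mulr_gt0 ?subr_gt0.
lra.
Qed.

Lemma tilted_argmin_opp {R : realType} (D : R -> R) (Theta : set R) (y w : R) :
  tilted_argmin D Theta y w ->
  tilted_argmin (D \o -%R) (-%R @^-1` Theta) (- y) (- w).
Proof.
move=> [Tw wmin]; split=> [|v Tv] /=; first by rewrite opprK.
by have := wmin _ Tv; rewrite opprK mulrNN mulNr mulrN.
Qed.

(** * Tail comparison for symmetric laws *)

Lemma measurable_RV_preimage {R : realType} {d : measure_display} {T : measurableType d}
    (P : probability T R) (X : {RV P >-> R}) (A : set R) :
  measurable A -> measurable (X @^-1` A).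
Proof. by move=> mA; rewrite -[_ @^-1` _]setTI; exact: measurable_funPT. Qed.

Lemma symmetric_rv_opp {R : realType} {d : measure_display} {T : measurableType d}
    (P : probability T R) (X : {RV P >-> R}) :
  symmetric_rv X -> symmetric_rv (- X : {RV P >-> R}).
Proof. by move=> Xsym A mA; rewrite opprK [RHS]Xsym. Qed.

(* If [w + v > 0], then [Y < y] forces [W > c] and [W < - c] forces [Y >= z] for a
   suitable [c], so by symmetry [P (Y < y) <= P (Y <= - z)] although [- z < y]. *)
Lemma symmetric_argmin_le {R : realType} {d : measure_display} {T : measurableType d}
    (P : probability T R) (D : R -> R) (Theta : set R) (Y W : {RV P >-> R}) :
  symmetric_rv Y -> symmetric_rv W ->
  (forall a b, a < b -> (0 < P (Y @^-1` `]a, b[))%E) ->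
  {ae P, forall t, tilted_argmin D Theta (Y t) (W t)} ->
  forall y z w v, tilted_argmin D Theta y w -> tilted_argmin D Theta z v ->
  0 < y + z -> w + v <= 0.
Proof.
move=> Ysym Wsym Ypos Wmin y z w v wmin vmin yz; rewrite leNgt; apply/negP => wv.
(* The midpoint of [- v] and [w]: as [w + v > 0], both [c < w] and [- c < v] hold. *)
pose c := (w - v) / 2.
have mY := measurable_RV_preimage P Y; have mW := measurable_RV_preimage P W.
have lo : (P (Y @^-1` `]-oo, y[) <= P (W @^-1` `]c, +oo[))%E.
  apply: ae_le_measure; [exact: mY|exact: mW|].
  apply: filterS Wmin => t Wt; rewrite /= !in_itv/= andbT => Yy.
  have := tilted_argmin_antitone _ _ _ _ _ _ Wt wmin Yy.
  by rewrite /c; lra.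
have hi : (P (W @^-1` `]-oo, (- c)%R[) <= P (Y @^-1` `[z, +oo[))%E.
  apply: ae_le_measure; [exact: mW|exact: mY|].
  apply: filterS Wmin => t Wt; rewrite /= !in_itv/= andbT => Wc.
  rewrite leNgt; apply/negP => Yz.
  have := tilted_argmin_antitone _ _ _ _ _ _ Wt vmin Yz.
  by move: Wc; rewrite /c; lra.
have eW : P (W @^-1` `]c, +oo[) = P (W @^-1` `]-oo, (- c)[).
  rewrite [LHS](Wsym `]c, +oo[%classic (measurable_itv _)); congr (P _).
  by apply/seteqP; split=> t /=; rewrite !in_itv/= andbT ltrNr.
have eY : P (Y @^-1` `[z, +oo[) = P (Y @^-1` `]-oo, (- z)]).
  rewrite [LHS](Ysym `[z, +oo[%classic (measurable_itv _)); congr (P _).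
  by apply/seteqP; split=> t /=; rewrite !in_itv/= andbT lerNr.
have zy : - z < y by lra.
have split_itv : Y @^-1` `]-oo, y[ = Y @^-1` `]-oo, (- z)] `|` Y @^-1` `](- z), y[.
  apply/seteqP; split=> t /=; rewrite !in_itv/=.
    by move=> ->; case: (lerP (Y t) (- z)) => _; [left|right].
  by case=> [/le_lt_trans->//|/andP[]].
(* The chain bounds [P (Y <= - z) + P (- z < Y < y)] by [P (Y <= - z)], which is finite, although
   the second term is positive. *)
have := lo; rewrite eW => /le_trans/(_ hi); rewrite eY split_itv measureU;
  [|exact: mY|exact: mY|]; last first.
  apply/seteqP; split=> t //=; rewrite !in_itv/= => -[] + /andP[].
  by rewrite leNgt => /negbTE->.
by rewrite leNgt lteDl ?Ypos// fin_num_measure//; exact: mY.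
Qed.

(** Reflection through zero turns this into the previous bound, for [- Y] and [- W]. *)
Lemma symmetric_argmin_ge {R : realType} {d : measure_display} {T : measurableType d}
    (P : probability T R) (D : R -> R) (Theta : set R) (Y W : {RV P >-> R}) :
  symmetric_rv Y -> symmetric_rv W ->
  (forall a b, a < b -> (0 < P (Y @^-1` `]a, b[))%E) ->
  {ae P, forall t, tilted_argmin D Theta (Y t) (W t)} ->
  forall y z w v, tilted_argmin D Theta y w -> tilted_argmin D Theta z v ->
  y + z < 0 -> 0 <= w + v.
Proof.
move=> Ysym Wsym Ypos Wmin y z w v /tilted_argmin_opp wmin /tilted_argmin_opp vmin yz.
suff : - w + - v <= 0 by lra.
apply: (symmetric_argmin_le P _ _ (- Y) (- W)) wmin vmin _; last by lra.
- exact: symmetric_rv_opp.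
- exact: symmetric_rv_opp.
- move=> a b ab; have := Ypos _ _ ab.
  by rewrite [X in (_ < X)%E](Ysym `]a, b[%classic (measurable_itv _)).
- by apply: filterS Wmin => t /tilted_argmin_opp.
Qed.

(** * From evenness to symmetry *)

(** Open upper rays are stable under intersection, generate the Borel sets and exhaust the line, so
    they determine a finite measure. *)
Lemma eq_in_law_of_ray {R : realType} {d : measure_display} {T : measurableType d}
    (P : probability T R) (X X' : {RV P >-> R}) :
  (forall c, P (X @^-1` `]c, +oo[) = P (X' @^-1` `]c, +oo[)) -> eq_in_law X X'.
Proof.
move=> eqXX' A mA.
apply: (measure_unique (@RGenOInfty.G R) (fun n => `](- n%:R), +oo[%classic) _ _ _ _
  (distribution P X) (distribution P X')) => //.
- exact: RGenOInfty.measurableE.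
- move=> _ _ [a ->] [b ->]; exists (Num.max a b).
  by apply/seteqP; split=> x /=; rewrite !in_itv/= !andbT gt_max => /andP.
- by move=> n; exists (- n%:R).
- apply/seteqP; split=> // x _; exists (Num.truncn `|x|).+1 => //=.
  rewrite in_itv/= andbT ltrNl; apply: le_lt_trans (truncnS_gt _).
  by rewrite -normrN ler_norm.
- by move=> _ [c ->]; exact: eqXX'.
- by move=> n; exact: le_lt_trans (probability_le1 _ _) (ltry _).
Qed.

(* [W > c] happens exactly when [Y] lies below some tilt having a minimizer beyond [c],
   and evenness turns [- W > c] into the same event for [- Y]. *)
Lemma symmetric_rv_of_even {R : realType} {d : measure_display} {T : measurableType d}
    (P : probability T R) (D : R -> R) (Theta : set R) (Y W : {RV P >-> R}) :
  symmetric_rv Y ->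
  {ae P, forall t u, tilted_argmin D Theta (Y t) u <-> u = W t} ->
  (forall y u, tilted_argmin D Theta y u -> tilted_argmin D Theta (- y) (- u)) ->
  symmetric_rv W.
Proof.
move=> Ysym Wuniq argminN; apply: eq_in_law_of_ray => c.
(* Closing downwards in the tilt makes [B] an interval, hence Borel. *)
pose B := [set y | exists y0 w, [/\ y <= y0, c < w & tilted_argmin D Theta y0 w]].
have mB : measurable B.
  apply: is_interval_measurable => x z _ [y0 [w [zy0 cw wmin]]] y /andP[_ yz].
  by exists y0, w; split=> //; exact: le_trans zy0.
have mY := measurable_RV_preimage P.
have in_B y u : c < u -> tilted_argmin D Theta y u -> B y.
  by move=> cu umin; exists y, u.
(* Antitonicity covers [y < y0]; uniqueness of the minimizer settles [y = y0]. *)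
have of_B y u : (forall v, tilted_argmin D Theta y v <-> v = u) -> B y -> c < u.
  move=> uuniq [y0 [w [+ cw wmin]]]; rewrite le_eqVlt => /orP[/eqP yy0|yy0].
    by rewrite -(iffLR (uuniq w))// yy0.
  apply: lt_le_trans cw (tilted_argmin_antitone _ _ _ _ _ _ _ wmin yy0).
  exact/uuniq.
have WB : P (W @^-1` `]c, +oo[) = P (Y @^-1` B).
  apply/eqP; rewrite eq_le; apply/andP; split.
    apply: ae_le_measure; [exact: mY|exact: mY|].
    apply: filterS Wuniq => t Wt; rewrite /= in_itv/= andbT => cW.
    by apply: in_B cW _; apply/(Wt _).
  apply: ae_le_measure; [exact: mY|exact: mY|].
  by apply: filterS Wuniq => t Wt; rewrite /= in_itv/= andbT; exact: of_B.
have NWB : P ((- W) @^-1` `]c, +oo[) = P ((- Y) @^-1` B).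
  (* The same [B] serves for [- W], since [- W t] is almost surely the unique minimizer for the tilt
     [- Y t]. *)
  have Wuniq' : {ae P, forall t u, tilted_argmin D Theta (- Y t) u <-> u = - W t}.
    apply: filterS Wuniq => t Wt u; split=> [/argminN|->].
      by rewrite opprK => /Wt <-; rewrite opprK.
    exact/argminN/Wt.
  apply/eqP; rewrite eq_le; apply/andP; split.
    apply: ae_le_measure; [exact: mY|exact: mY|].
    apply: filterS Wuniq' => t Wt; rewrite /= in_itv/= andbT => cW.
    by apply: in_B cW _; apply/(Wt _).
  apply: ae_le_measure; [exact: mY|exact: mY|].
  by apply: filterS Wuniq' => t Wt; rewrite /= in_itv/= andbT; exact: of_B.
by rewrite WB NWB; exact: Ysym.
Qed.

(** * From symmetry to evenness *)

(** One implication on [Theta] suffices: applied at [- u], it shows that both values are [+oo] when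
    [u] is outside [Theta]. *)
Lemma even_objectiveP {R : realType} (D : R -> R) (Theta : set R) :
  even_function (objective D Theta) <->
  forall u, Theta u -> Theta (- u) /\ D (- u) = D u.
Proof.
rewrite /even_function /objective /cvx_indicator; split=> [feven u Tu|TDN u].
  have := feven u; rewrite (mem_set Tu) adde0.
  by case: ifPn => [/set_mem TNu|_]; rewrite ?adde0// => -[].
have [Tu|nTu] := pselect (Theta u).
  by have [TNu ->] := TDN _ Tu; rewrite (mem_set Tu) (mem_set TNu).
have nTNu : ~ Theta (- u) by move=> /TDN[]; rewrite opprK.
by rewrite (memNset nTu) (memNset nTNu) !addey.
Qed.

Lemma even_objective_of_symmetric {R : realType} {d : measure_display}
    {T : measurableType d} (P : probability T R) (D : R -> R) (Theta : set R)
    (Y W : {RV P >-> R}) :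
  @convex_function R R^o setT D -> @convex_set R R^o Theta ->
  symmetric_rv Y -> symmetric_rv W ->
  (forall a b, a < b -> (0 < P (Y @^-1` `]a, b[))%E) ->
  {ae P, forall t, tilted_argmin D Theta (Y t) (W t)} ->
  even_function (objective D Theta).
Proof.
move=> D_convex Theta_convex Ysym Wsym Ypos Wmin.
have [s Ds] := choice (convex_subgradient _ D_convex).
have argmin_s u := tilted_argmin_subgradient D Theta u _ (Ds u).
have sum_le := symmetric_argmin_le P _ _ _ _ Ysym Wsym Ypos Wmin.
have sum_ge := symmetric_argmin_ge P _ _ _ _ Ysym Wsym Ypos Wmin.
have good a b : a < b ->
    exists t, a < Y t < b /\ tilted_argmin D Theta (Y t) (W t).
  move=> ab; have [|t [Yt Wt]] := ae_exists _ _ _ _ (Ypos _ _ ab) Wmin.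
    exact: measurable_RV_preimage.
  by exists t; move: Yt; rewrite /= in_itv.
have ThetaN u : Theta u -> Theta (- u).
  move=> Tu.
  (* As [u] is optimal for the tilt [- s u], an outcome with [Y > s u] has [W <= - u], and one with
     [Y < s u] has [W >= - u]; thus [- u] lies between two points of [Theta]. *)
  have [t1 [/andP[Y1 _] W1]] := good (s u) (s u + 1) ltac:(lra).
  have [t2 [/andP[_ Y2] W2]] := good (s u - 1) (s u) ltac:(lra).
  apply: (convex_set_itv _ (W t1) (W t2)); [by []|exact: W1.1|exact: W2.1|].
  have := sum_le _ _ _ _ W1 (argmin_s u Tu).
  have := sum_ge _ _ _ _ W2 (argmin_s u Tu).
  lra.
(* Contrapositive of [sum_le] at the tilts [- s x] and [- s y]. *)
have s_sum_ge x y : Theta x -> Theta y -> 0 < x + y -> 0 <= s x + s y.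
  move=> /argmin_s xmin /argmin_s ymin; have := sum_le _ _ _ _ xmin ymin.
  lra.
have s_sum_le x y : Theta x -> Theta y -> x + y < 0 -> s x + s y <= 0.
  move=> /argmin_s xmin /argmin_s ymin; have := sum_ge _ _ _ _ xmin ymin.
  lra.
have evenD u : 0 <= u -> Theta u -> D (- u) = D u.
  move=> u_ge0 Tu.
  have Tx x : - u <= x <= u -> Theta x.
    by apply: convex_set_itv => //; exact: ThetaN.
  apply/eqP; rewrite eq_le; apply/andP; split.
    apply: (le_reflect_of_subgradient D s) => // x y /Tx Tx' /Tx; exact: s_sum_ge.
  (* The reverse inequality is the same partition bound for the reflected function, with
     subgradients [- s (- x)]. *)
  rewrite -{1}[u]opprK.
  apply: (le_reflect_of_subgradient (D \o -%R) (fun x => - s (- x))) => //.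
    by move=> x v /=; have := Ds (- x) (- v); lra.
  move=> x y /Tx/ThetaN Tx' /Tx/ThetaN Ty' xy.
  have := s_sum_le _ _ Tx' Ty'; lra.
apply/even_objectiveP => u Tu; split; first exact: ThetaN.
have [u_ge0|u_lt0] := lerP 0 u; first exact: evenD.
by rewrite -{2}[u]opprK [RHS]evenD ?oppr_ge0 1?ltW//; exact: ThetaN.
Qed.

Theorem theorem4p4
  (R : realType) (d : measure_display) (T : measurableType d)
  (P : probability T R)
  (D : R -> R)
  (D_ge0 : forall u, 0 <= D u)
  (D_convex : @convex_function R R^o setT D)
  (D0 : D 0 = 0)
  (Theta : set R)
  (Theta_neq0 : Theta !=set0)
  (Theta_closed : closed Theta)
  (Theta_convex : @convex_set R R^o Theta)
  (Y W : {RV P >-> R})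
  (Y_integrable : P.-integrable setT (EFin \o Y))
  (Y_mean0 : ('E_P[Y] = 0)%E)
  (W_welldef : {ae P, forall t, exists! u, is_minimizer (Zproc D Theta Y t) u})
  (W_minimizer : {ae P, forall t, is_minimizer (Zproc D Theta Y t) (W t)})
  (Y_symmetric : symmetric_rv Y)
  (Y_dominates : content_dominates (distribution P Y) (@lebesgue_measure R)) :
  symmetric_rv W <-> even_function (objective D Theta).
Proof.
have Zmin t u := is_minimizer_Zproc T D Theta Y t u Theta_neq0.
split=> [W_symmetric|/even_objectiveP TDN].
  apply: even_objective_of_symmetric Y_symmetric W_symmetric _ _ => //.
    by move=> a b; exact: distribution_itv_gt0.
  by apply: filterS W_minimizer => t /Zmin.
apply: (symmetric_rv_of_even P D Theta Y W) => //.
  (* Almost surely [W t] is a minimizer, hence equals the unique one. *)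
  apply: filterS2 W_welldef W_minimizer => t [u [umin uuniq]] Wmin v.
  split=> [/Zmin vmin|->]; last exact/Zmin.
  by rewrite -(uuniq _ vmin) -(uuniq _ Wmin).
move=> y u [Tu umin]; split=> [|v Tv]; first by have [] := TDN _ Tu.
have [TNv Dv] := TDN _ Tv; have := umin _ TNv.
by rewrite Dv (TDN _ Tu).2 mulrNN mulNr mulrN.
Qed.
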